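(* Let $k\ge1$ and let $\bar P_{(k,k)}$ be the poset on $\{a_1,\dots,a_k,b_1,\dots,b_k\}$ generated by the cover relations $a_{j+1}\prec a_j$ for $1\le j\le k-1$ and $b_j\prec a_j$ for $1\le j\le k$. Then \[ \mathrm{Ehr}(\mathcal{O}(\bar P_{(k,k)}),x)=\frac{\sum_{i=1}^kT(k,i)x^{i-1}}{(1-x)^{2k+1}}, \] where $T(k,i)$, $1\le i\le k$, is the second-order Eulerian triangle, defined by $T(1,1)=1$, $T(m,i)=0$ unless $1\le i\le m$, and $T(m,i)=i\,T(m-1,i)+(2m-i)\,T(m-1,i-1)$ for $m\ge2$.
   Context: For a finite poset $P$, the order polytope $\mathcal{O}(P)\subset\mathbb{R}^P$ is defined by $0\le x_s\le1$ and $x_s\le x_{s'}$ whenever $s\prec s'$; $\mathrm{ehr}(\mathcal{O}(P),n)=|n\mathcal{O}(P)\cap\mathbb{Z}^P|$ for $n\ge1$, and $\mathrm{Ehr}(\mathcal{O}(P),x)=1+\sum_{n\ge1}\mathrm{ehr}(\mathcal{O}(P),n)x^n$. The second-order Eulerian triangle (OEIS A008517) has rows $1$; $1,2$; $1,8,6$; $1,22,58,24$; $\dots$ *)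

(* Defs.v *)
From HB Require Import structures.
From mathcomp Require Import all_boot all_order all_algebra finmap.
From mathcomp Require Import boolp classical_sets functions cardinality reals.

Set Implicit Arguments.
Unset Strict Implicit.
Unset Printing Implicit Defensive.

Import Order.TTheory GRing.Theory Num.Theory.

Local Open Scope classical_set_scope.
Local Open Scope ring_scope.

(* Formal power series over A, as coefficient sequences. *)
Section FormalPowerSeries.
Variable A : comUnitRingType.
Implicit Types f g : nat -> A.

Definition fps_mul f g : nat -> A :=
  fun n => \sum_(i < n.+1) f i * g (n - i)%N.

Definition fps_of_poly (p : {poly A}) : nat -> A := fun n => p`_n.

(* The first n coefficients of the multiplicative inverse of f, each solved
   for in terms of the previous ones; meaningful when f 0 is a unit. *)
Fixpoint fps_inv_seq f n : seq A :=
  if n is m.+1 then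
    let s := fps_inv_seq f m in
    rcons s ((f 0%N)^-1 * ((m == 0%N)%:R - \sum_(j < m) f (m - j)%N * s`_j))
  else [::].

Definition fps_inv f : nat -> A := fun n => (fps_inv_seq f n.+1)`_n.

Definition fps_div f g : nat -> A := fps_mul f (fps_inv g).

Lemma size_fps_inv_seq f n : size (fps_inv_seq f n) = n.
Proof. by elim: n => //= n IHn; rewrite size_rcons IHn. Qed.

Lemma nth_fps_inv_seq f n j : (j < n)%N -> (fps_inv_seq f n)`_j = fps_inv f j.
Proof.
elim: n => // n IHn; rewrite ltnS leq_eqVlt => /orP[/eqP-> // | ltjn].
by rewrite /= nth_rcons size_fps_inv_seq ltjn IHn.
Qed.

Lemma fps_invE f n :
  fps_inv f n =
  (f 0%N)^-1 * ((n == 0%N)%:R - \sum_(j < n) f (n - j)%N * fps_inv f j).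
Proof.
rewrite {1}/fps_inv /= nth_rcons size_fps_inv_seq ltnn eqxx.
by under eq_bigr => j _ do rewrite nth_fps_inv_seq //.
Qed.

Lemma fps_invK f n : f 0%N \is a GRing.unit ->
  fps_mul (fps_inv f) f n = (n == 0%N)%:R.
Proof.
move=> f0u; rewrite /fps_mul big_ord_recr /= subnn [fps_inv f n]fps_invE.
rewrite [_ * f 0%N]mulrC mulVKr //.
by under eq_bigr => j _ do rewrite mulrC; rewrite addrC subrK.
Qed.

End FormalPowerSeries.

Section Ehrhart.
Variables (R : realType) (d : Order.disp_t) (P : finPOrderType d).

Definition order_polytope : set {ffun P -> R} :=
  [set x | (forall s, 0 <= x s <= 1) /\
           (forall s t, (s < t)%O -> x s <= x t)].

Definition lattice_points : set {ffun P -> R} :=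
  [set x | forall s, x s \is a Num.int].

Definition dilate (n : nat) (X : set {ffun P -> R}) : set {ffun P -> R} :=
  [set [ffun s => n%:R * x s] | x in X].

(* [fset_set] sends infinite sets to the empty one, hence the next lemma. *)
Definition ehr (X : set {ffun P -> R}) (n : nat) : nat :=
  #|` fset_set (dilate n X `&` lattice_points)|.

Lemma finite_dilate_order_polytope n :
  finite_set (dilate n order_polytope `&` lattice_points).
Proof.
pose h (z : {ffun P -> 'I_n.+1}) : {ffun P -> R} := [ffun s => (z s)%:R].
apply: (@sub_finite_set _ _ (h @` setT)); last first.
  exact/finite_image/finite_finset.
move=> y [[x [x01 _] <-] xZ].
exists [ffun s => inord `|Num.floor (n%:R * x s)|] => //.
apply/ffunP => s; rewrite !ffunE.
have /andP[x_ge0 x_le1] := x01 s.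
have := xZ s; rewrite !ffunE => /intrP[m eqm].
have m_ge0 : 0 <= m by rewrite -(ler0z R) -eqm mulr_ge0.
have m_len : m <= n%:Z.
  by rewrite -(ler_int R) -eqm -[leRHS]mulr1 ler_wpM2l ?ler0n.
rewrite eqm intrKfloor inordK; last first.
  by rewrite ltnS -lez_nat gez0_abs.
by rewrite -[LHS]/((`|m|%N : int)%:~R) gez0_abs.
Qed.

Definition Ehr (X : set {ffun P -> R}) : nat -> int :=
  fun n => if n is 0 then 1 else (ehr X n)%:Z.

End Ehrhart.

Section BarP.
Variable k : nat.

(* [inl j] stands for a_(j+1) and [inr j] for b_(j+1). *)
Definition barP : Type := ('I_k + 'I_k)%type.
HB.instance Definition _ := Finite.on barP.

Definition barP_cover : rel barP := fun x y =>
  match x, y with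
  | inl i, inl j => i == j.+1 :> nat
  | inr i, inl j => i == j
  | _, inr _ => false
  end.

Definition barP_le : rel barP := connect barP_cover.

Fact barP_le_refl : reflexive barP_le.
Proof. exact: connect0. Qed.

Fact barP_le_trans : transitive barP_le.
Proof. exact: connect_trans. Qed.

Fact barP_le_anti : antisymmetric barP_le.
Proof.
pose r (x : barP) := match x with inl i => (i : nat) | inr i => i.+1 end.
have r_cover x y : barP_cover x y -> (r y < r x)%N.
  by case: x y => i [] j //= /eqP->.
have r_path p x : path barP_cover x p ->
    (x = last x p) \/ (r (last x p) < r x)%N.
  elim: p x => [|y p IHp] x /=; first by left.
  case/andP=> /r_cover lt_yx /IHp[<- | lt_py]; right => //.
  exact: ltn_trans lt_yx.
move=> x y /andP[/connectP[p /r_path xp ->] /connectP[q /r_path yq eq_x]].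
case: xp => // lt_px; case: yq; rewrite -eq_x; first by move->.
by move/(ltn_trans lt_px); rewrite ltnn.
Qed.

Fact barP_display : Order.disp_t. Proof. exact: Order.Disp tt tt. Qed.

HB.instance Definition _ := Order.Le_isPOrder.Build barP_display barP
  barP_le_refl barP_le_anti barP_le_trans.

End BarP.

Fixpoint eulerian2 (m i : nat) : nat :=
  match m with
  | 0 => 0
  | 1 => (i == 1)
  | m'.+1 =>
      if (1 <= i <= m)%N
      then (i * eulerian2 m' i + (2 * m - i) * eulerian2 m' i.-1)%N
      else 0
  end.

(* Main.v *)
(* Listing the entries of a lattice point of the [n]-th dilate as
   [(a_1, b_1), ..., (a_k, b_k)], the constraints read [n >= a_1 >= ... >= a_k]
   and [0 <= b_j <= a_j], so the number [c_k(n)] of lattice points satisfies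
   [c_k(n) = c_k(n - 1) + (n + 1) c_(k-1)(n)].  The same recurrence holds for
   [\sum_i T(k, i) 'C(n + 1 + 2k - i, 2k)], by the recurrence defining [T] and
   the Worpitzky-type identity [bin_weight]; and this sum is the coefficient of
   [x^n] in [\sum_i T(k, i) x^(i-1) / (1 - x)^(2k+1)]. *)
Require Import Defs.
From mathcomp Require Import finmap zify ring.
From mathcomp Require Import boolp classical_sets cardinality.
From mathcomp Require Import all_boot all_order all_algebra reals.
Import Order.TTheory GRing.Theory Num.Theory.
Local Open Scope classical_set_scope.
Local Open Scope ring_scope.

(** * Second-order Eulerian numbers and the Worpitzky-type sum *)

Lemma eulerian2_small m : eulerian2 m 0 = 0%N.
Proof. by case: m => [|[|m]]. Qed.

Lemma eulerian2_large m i : (m < i)%N -> eulerian2 m i = 0%N.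
Proof.
case: m i => [|[|m]] [|[|i]] // lt_mi.
by rewrite [LHS]/= ifN // -leqNgt.
Qed.

Lemma eulerian2_rec m i : (0 < m)%N -> (i <= m)%N ->
  eulerian2 m.+1 i.+1 =
    (i.+1 * eulerian2 m i.+1 + (2 * m.+1 - i.+1) * eulerian2 m i)%N.
Proof.
case: m => [//|m] _ le_im.
exact: (@ifT _ (0 < i.+1 <= m.+2)%N).
Qed.

(** With the index shifted to start at 0, the binomial is the coefficient of x^n in x^i / (1 -
    x)^(2k+1); it vanishes for i > n. *)
Definition eulerian2_bin k n :=
  (\sum_(i < k) eulerian2 k i.+1 * 'C(n + 2 * k - i, 2 * k))%N.

(** Put N = n + r - i. Pascal's rule turns the right side into (i + 1) C(N, r) + (r + 1) C(N, r +
    1), and (r + 1) C(N, r + 1) = (N - r) C(N, r). *)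
Lemma bin_weight i j n r : (i + j = r)%N -> (i <= n + r)%N ->
  (n.+1 * 'C(n + r - i, r) =
     i.+1 * 'C((n + r - i).+1, r.+1) + j * 'C(n + r - i, r.+1))%N.
Proof.
move=> eq_r le_i; rewrite binS mulnDr addnAC -mulnDl.
have -> : (i.+1 + j = r.+1)%N by lia.
(* If N < r, every binomial is 0; otherwise N - r is a true difference, equal to n - i. *)
have [lt_r | le_r] := ltnP (n + r - i) r.
  by rewrite !bin_small ?muln0 // ltnW.
by rewrite mul_bin_left -mulnDl; congr (_ * _)%N; lia.
Qed.

(** Regrouping by row k: T(k, i + 1) feeds T(k + 1, i + 1) with weight i + 1 and T(k + 1, i + 2)
    with weight 2k - i. The boundary terms T(k, k + 1) and T(k, 0) are zero. *)
Lemma eulerian2_binE k n : (0 < k)%N ->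
  eulerian2_bin k.+1 n =
  (\sum_(i < k) eulerian2 k i.+1 *
     (i.+1 * 'C(n + 2 * k.+1 - i, 2 * k.+1) +
      (2 * k - i) * 'C(n + 2 * k.+1 - i.+1, 2 * k.+1)))%N.
Proof.
move=> k_gt0; rewrite /eulerian2_bin.
under eq_bigr => i _ do
  rewrite (eulerian2_rec _ _ k_gt0 (ltn_ord i : (i <= k)%N)) mulnDl.
rewrite big_split /= big_ord_recr /= eulerian2_large // muln0 mul0n addn0.
rewrite [X in (_ + X)%N]big_ord_recl /= eulerian2_small muln0 mul0n add0n.
rewrite -big_split /=; apply: eq_bigr => i _.
rewrite /bump /= add1n mulnDr !mulnA.
have -> : (2 * k.+1 - i.+2 = 2 * k - i)%N by lia.
by rewrite ![(_ * eulerian2 _ _)%N]mulnC.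
Qed.

(** The identity holds term by term in [i]: the increments that Pascal's rule gives to the two
    binomials of [eulerian2_binE] are the right side of [bin_weight]. *)
Lemma eulerian2_binS k n : (0 < k)%N ->
  eulerian2_bin k.+1 n.+1 =
  (eulerian2_bin k.+1 n + n.+2 * eulerian2_bin k n.+1)%N.
Proof.
move=> k_gt0; rewrite !eulerian2_binE // big_distrr -big_split /=.
apply: eq_bigr => i _; rewrite mulnCA -mulnDr; congr (_ * _)%N.
have lt_ik := ltn_ord i.
have -> : (2 * k.+1 = (2 * k).+2)%N by lia.
rewrite (bin_weight i (2 * k - i)); [|lia|lia].
have -> : (n.+1 + (2 * k).+2 - i = (n.+1 + 2 * k - i).+2)%N by lia.
have -> : (n + (2 * k).+2 - i = (n.+1 + 2 * k - i).+1)%N by lia.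
have -> : (n.+1 + (2 * k).+2 - i.+1 = (n.+1 + 2 * k - i).+1)%N by lia.
have -> : (n + (2 * k).+2 - i.+1 = n.+1 + 2 * k - i)%N by lia.
by rewrite [in LHS]binS [in X in (_ + X)%N]binS; ring.
Qed.

Lemma eulerian2_bin0 k : (0 < k)%N -> eulerian2_bin k 0 = 1%N.
Proof.
have -> : eulerian2_bin k 0 = eulerian2 k 1.
  case: k => [|k]; first by rewrite /eulerian2_bin big_ord0.
  rewrite /eulerian2_bin big_ord_recl add0n subn0 binn muln1.
  rewrite big1 ?addn0 // => i _.
  by rewrite bin_small ?muln0 // lift0; lia.
elim: k => // -[|k] IHk _ //.
by rewrite eulerian2_rec // eulerian2_small muln0 addn0 mul1n IHk.
Qed.

(** * Enumerating and counting chains of pairs *)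

Definition ordered_pairs (n : nat) : seq (nat * nat) :=
  [seq (a, b) | a <- iota 0 n.+1, b <- iota 0 a.+1].

Lemma mem_ordered_pairs n p :
  (p \in ordered_pairs n) = (p.2 <= p.1)%N && (p.1 <= n)%N.
Proof.
apply/allpairsPdep/andP => [[a [b [+ + ->]]] | [le_ba le_an]].
  by rewrite !mem_iota !ltnS.
by exists p.1, p.2; rewrite !mem_iota !ltnS -surjective_pairing.
Qed.

Lemma uniq_ordered_pairs n : uniq (ordered_pairs n).
Proof.
apply: allpairs_uniq_dep => [|a _|]; rewrite ?iota_uniq //.
by move=> [a b] [c d] _ _ /= [<- <-].
Qed.

(* The entries [(a_j, b_j)] of a lattice point of the [n]-th dilate, listed
   from the top element [a_1] down. *)
Fixpoint chains (k n : nat) : seq (seq (nat * nat)) :=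
  if k is k'.+1 then
    [seq p :: s | p <- ordered_pairs n, s <- chains k' p.1]
  else [:: [::]].

Definition chain_step : rel (nat * nat) :=
  fun p q => (q.2 <= q.1)%N && (q.1 <= p.1)%N.

Lemma mem_chains k n s :
  (s \in chains k n) = (size s == k) && path chain_step (n, 0%N) s.
Proof.
elim: k n s => [|k IHk] n s; first by rewrite inE; case: s.
(* [chain_step] reads only the first entry of its left argument, so the recursive bound [p.1]
   amounts to a path starting at [p]. *)
have path_fst p t : path chain_step (p.1, 0%N) t = path chain_step p t.
  by case: t.
apply/allpairsPdep/idP => [[p [t [p_n]]] | ].
  rewrite mem_ordered_pairs in p_n; rewrite IHk path_fst => /andP[sz_t t_p] ->.
  by rewrite /= eqSS sz_t /chain_step p_n.
case: s => // p s /and3P[sz_s p_n s_p].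
by exists p, s; rewrite mem_ordered_pairs IHk path_fst; split=> //; apply/andP.
Qed.

Lemma uniq_chains k n : uniq (chains k n).
Proof.
elim: k n => // k IHk n.
apply: allpairs_uniq_dep => [|p _|]; [exact: uniq_ordered_pairs|exact: IHk|].
by move=> [p s] [q t] _ _ /= [<- <-].
Qed.

Lemma size_chains0 k : size (chains k 0) = 1%N.
Proof. by elim: k => //= k IHk; rewrite cats0 size_map IHk. Qed.

(** Split on a_1: either a_1 <= n, or a_1 = n + 1 with n + 2 choices for b_1 and a shorter chain
    still bounded by n + 1. *)
Lemma size_chainsS k n :
  size (chains k.+1 n.+1) =
  (size (chains k.+1 n) + n.+2 * size (chains k n.+1))%N.
Proof.
have pairsS : ordered_pairs n.+1 =
    ordered_pairs n ++ [seq (n.+1, b) | b <- iota 0 n.+2].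
  have iotaS : iota 0 n.+2 = iota 0 n.+1 ++ [:: n.+1] by rewrite -addn1 iotaD.
  by rewrite /ordered_pairs [in LHS]iotaS allpairs_cat allpairs1l.
rewrite !size_allpairs_dep pairsS map_cat sumn_cat; congr (_ + _)%N.
rewrite sumnE !big_map -[iota 0 n.+2]/(index_iota 0 n.+2) /=.
by rewrite sum_nat_const_nat subn0.
Qed.

Lemma size_chainsE k n : (0 < k)%N -> size (chains k n) = eulerian2_bin k n.
Proof.
elim: k n => // k IHk n _.
elim: n => [|n IHn]; first by rewrite size_chains0 eulerian2_bin0.
rewrite size_chainsS IHn; case: k IHk IHn => [_ _|k IHk IHn].
  (* Row 1 is checked directly, since [eulerian2_binS] starts from a positive row: C(n + 3, 2) = C(n
     + 2, 2) + n + 2. *)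
  rewrite /eulerian2_bin !big_ord1 /= !mul1n !subn0 !muln1.
  by rewrite addSn [in RHS]binS bin1; lia.
by rewrite eulerian2_binS // IHk.
Qed.

(** * Lattice points of the dilated order polytope *)

Definition barP_point (R : realType) (k : nat) (s : seq (nat * nat)) :
    {ffun barP k -> R} :=
  [ffun x => match x : 'I_k + 'I_k with
             | inl i => (nth (0, 0) s i).1%:R
             | inr i => (nth (0, 0) s i).2%:R
             end%N].

Lemma barP_point_inj (R : realType) k :
  {in [pred s | size s == k] &, injective (barP_point R k)}.
Proof.
move=> s t /eqP sz_s /eqP sz_t eq_st.
apply: (@eq_from_nth _ (0, 0)%N) => [|i]; first by rewrite sz_s.
rewrite sz_s => lt_ik; move/ffunP: eq_st => eq_st.
have := eq_st (inl (Ordinal lt_ik)); have := eq_st (inr (Ordinal lt_ik)).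
rewrite !ffunE /= => /eqP + /eqP; rewrite !eqr_nat => /eqP eq2 /eqP eq1.
by rewrite [LHS]surjective_pairing eq1 eq2 -surjective_pairing.
Qed.

(** The order is the reflexive-transitive closure of the covers, so monotonicity propagates along a
    path of covers. *)
Lemma barP_homo d (T : porderType d) k (f : barP k -> T) :
  (forall x y, @barP_cover k x y -> (f x <= f y)%O) ->
  forall x y, (x < y)%O -> (f x <= f y)%O.
Proof.
move=> f_cover x y /ltW /connectP[p + ->].
elim: p x => //= z p IHp x /andP[/f_cover le_xz /IHp]; exact: le_trans.
Qed.

Lemma barP_cover_lt k x y : @barP_cover k x y -> (x < y)%O.
Proof.
move=> xy; rewrite lt_neqAle; apply/andP; split; last exact: connect1.
case: x y xy => i [] j //= /eqP + ; apply: contra_eq_neq => -[->].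
by rewrite neq_ltn ltnSn.
Qed.

Lemma mem_chainsP k n s : size s = k ->
  reflect
    [/\ forall i, (i < k)%N -> ((nth (0, 0) s i).1 <= n)%N,
        forall i, (i.+1 < k)%N ->
          ((nth (0, 0) s i.+1).1 <= (nth (0, 0) s i).1)%N
      & forall i, (i < k)%N -> ((nth (0, 0) s i).2 <= (nth (0, 0) s i).1)%N]
    (s \in chains k n).
Proof.
move=> sz_s; rewrite mem_chains sz_s eqxx /=.
apply: (iffP (pathP (0, 0)%N)) => [s_step|[s_n s_a s_b] i].
  have step i : (i < k)%N -> ((nth (0, 0) s i).2 <= (nth (0, 0) s i).1)%N /\
      ((nth (0, 0) s i).1 <= (nth (0, 0) ((n, 0) :: s) i).1)%N.
    by move=> lt_i; apply/andP; apply: s_step; rewrite sz_s.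
  split=> [|i /step[] //|i /step[] //].
  elim=> [|i IHi] lt_ik; first by have [] := step _ lt_ik.
  by have [_ /leq_trans->] := step _ lt_ik; rewrite // IHi // ltnW.
rewrite sz_s => lt_ik; rewrite /chain_step s_b //=.
by case: i lt_ik => [|i] lt_ik; [exact: s_n | exact: s_a].
Qed.

Lemma ehr_barP (R : realType) k n : (0 < n)%N ->
  ehr (@order_polytope R _ (barP k)) n = size (chains k n).
Proof.
move=> n_gt0; have nR_gt0 : 0 < n%:R :> R by rewrite ltr0n.
have chain_size s : s \in chains k n -> size s = k.
  by rewrite mem_chains => /andP[/eqP].
rewrite /ehr.
have -> : dilate n (@order_polytope R _ (barP k)) `&`
    @lattice_points R _ (barP k) =
    [set` [fset y in map (barP_point R k) (chains k n)]%fset].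
  apply/seteqP; split=> [_ [[x [x01 x_le] <-] xZ] | y] /=; last first.
    rewrite in_fset => /mapP[s s_n ->]; have sz_s := chain_size s s_n.
    have [s_le s_a s_b] := mem_chainsP _ _ _ sz_s s_n.
    split; last first.
      by case=> i; rewrite ffunE natr_int.
    (* A chain gives a lattice point of the dilate: its preimage in the polytope is obtained by
       dividing by the positive n. *)
    exists [ffun p => n%:R^-1 * barP_point R k s p]; last first.
      by apply/ffunP => p; rewrite !ffunE mulrA mulfV ?gt_eqF // mul1r.
    split=> [p | ].
      rewrite !ffunE mulr_ge0 ?invr_ge0 ?ler0n //=; last first.
        by case: p => i; rewrite ler0n.
      rewrite mulrC ler_pdivrMr // mul1r.
      case: p => i; rewrite ler_nat; first exact: s_le.
      exact: leq_trans (s_b _ _) (s_le _ _).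
    apply: barP_homo => p q pq; rewrite !ffunE ler_pM2l ?invr_gt0 //.
    case: p q pq => i [] j //= /eqP eq_ij; rewrite ler_nat ?eq_ij.
      2: exact: s_b.
    by apply: s_a; rewrite -eq_ij.
  (* Conversely, the coordinates of a lattice point are nonnegative integers, read off by the floor
     and listed as a chain. *)
  pose v p := `|Num.floor (n%:R * x p)|%N.
  have vE p : (v p)%:R = n%:R * x p.
    have /andP[x_ge0 _] := x01 p; have := xZ p; rewrite ffunE => /intrP[m eqm].
    have m_ge0 : 0 <= m by rewrite -(ler0z R) -eqm mulr_ge0.
    by rewrite /v eqm intrKfloor -[LHS]/((`|m|%N : int)%:~R) gez0_abs.
  have v_le p q : (p < q)%O -> (v p <= v q)%N.
    by move=> /x_le le_pq; rewrite -(ler_nat R) !vE ler_pM2l.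
  have v_n p : (v p <= n)%N.
    by rewrite -(ler_nat R) vE ler_piMr ?ler0n //; have /andP[] := x01 p.
  pose s := [seq (v (inl i), v (inr i)) | i <- enum 'I_k].
  have sz_s : size s = k by rewrite size_map size_enum_ord.
  have sE (i : 'I_k) : nth (0, 0)%N s i = (v (inl i), v (inr i)).
    by rewrite (nth_map i) ?size_enum_ord // nth_ord_enum.
  rewrite in_fset; apply/mapP; exists s.
    apply/mem_chainsP => //; split=> i lt_i.
    - by rewrite (sE (Ordinal lt_i)) v_n.
    - rewrite (sE (Ordinal lt_i)) (sE (Ordinal (ltnW lt_i))); apply: v_le.
      by apply: barP_cover_lt; rewrite /= eqxx.
    - by rewrite (sE (Ordinal lt_i)); apply/v_le/barP_cover_lt; rewrite /= eqxx.
  by apply/ffunP => -[] i; rewrite !ffunE sE vE.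
rewrite set_fsetK card_fseq undup_id ?size_map //.
rewrite map_inj_in_uniq ?uniq_chains // => s t /chain_size s_k /chain_size t_k.
by apply: barP_point_inj; apply/eqP.
Qed.

(** * Power series division by powers of 1 - x *)

Lemma fps_mul_polyE (A : comUnitRingType) (p : {poly A}) (g : nat -> A) n N :
  (n < N)%N -> fps_mul (fps_of_poly p) g n = (p * \poly_(i < N) g i)`_n.
Proof.
move=> lt_nN; rewrite coefM; apply: eq_bigr => i _.
by rewrite coef_poly (leq_ltn_trans (leq_subr _ _)).
Qed.

(** Associativity moves the factor 1 - x onto [g], where it acts as the backward difference. *)
Lemma fps_mul_one_subX (A : comUnitRingType) (p : {poly A}) (g : nat -> A) n :
  fps_mul (fps_of_poly (p * (1 - 'X))) g n =
  fps_mul (fps_of_poly p) (fun i => g i - (if i is j.+1 then g j else 0)) n.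
Proof.
rewrite !(fps_mul_polyE _ _ _ n n.+1) // -mulrA !coefM.
apply: eq_bigr => i _; congr (_ * _).
have lt_n : (n - i < n.+1)%N by rewrite ltnS leq_subr.
rewrite mulrBl mul1r coefB coefXM !coef_poly lt_n.
by case: (n - i)%N lt_n => [|j] //= /ltnW ->.
Qed.

Lemma fps_inv_unique (A : comUnitRingType) (f g : nat -> A) :
  f 0%N \is a GRing.unit ->
  (forall n, fps_mul f g n = (n == 0%N)%:R) -> forall n, fps_inv f n = g n.
Proof.
move=> f0 fg; elim/ltn_ind => n IHn; rewrite fps_invE -fg /fps_mul.
(* Reversing the convolution puts [f 0 * g n] last, so that it can be isolated. *)
rewrite (reindex_inj rev_ord_inj) big_ord_recr /= subnn subn0 addrC.
rewrite (eq_bigr (fun j : 'I_n => f (n - j)%N * fps_inv f j)).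
  by rewrite addrK mulKr.
move=> i _; rewrite IHn //= subSS subKn //.
exact: ltnW.
Qed.

(** Induction on [m]: by Pascal's rule, the backward difference of C(n + m + 1, m + 1) in n is C(n +
    m, m). *)
Lemma fps_inv_one_subX_exp (A : comUnitRingType) m n :
  fps_inv (fps_of_poly ((1 - 'X : {poly A}) ^+ m.+1)) n = 'C(n + m, m)%:R.
Proof.
move: n; apply: (fps_inv_unique _ _ (fun n => 'C(n + m, m)%:R)) => [|n].
  by rewrite /fps_of_poly -horner_coef0 !hornerE subr0 expr1n unitr1.
elim: m n => [|m IHm] n; rewrite exprSr fps_mul_one_subX.
  rewrite expr0 (fps_mul_polyE _ _ _ n n.+1) // mul1r coef_poly ltnSn.
  by case: n => [|n]; rewrite !bin0 ?subr0 ?subrr.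
rewrite -IHm; apply: eq_bigr => i _; congr (_ * _).
case: (n - i)%N => [|j]; first by rewrite !add0n !binn subr0.
by rewrite !addSn !addnS binS natrD addrC addKr.
Qed.

Lemma sum_ord_vanish (F : nat -> nat) m N : (m <= N)%N ->
  (forall j, (m <= j)%N -> F j = 0%N) ->
  (\sum_(j < N) F j = \sum_(j < m) F j)%N.
Proof.
move=> le_mN F0; rewrite [RHS](big_ord_widen N F) // [RHS]big_mkcond.
by apply: eq_bigr => j _; case: ltnP => // /F0.
Qed.

Lemma eulerian2_gfE k n : (0 < k)%N ->
  fps_div
    (fps_of_poly
       (\sum_(1 <= i < k.+1) ((eulerian2 k i)%:R : int) *: 'X^(i.-1)))
    (fps_of_poly ((1 - 'X) ^+ (2 * k + 1))) n = (eulerian2_bin k n)%:R.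
Proof.
move=> k_gt0; pose F j := (eulerian2 k j.+1 * 'C(n + 2 * k - j, 2 * k))%N.
have -> : eulerian2_bin k n = (\sum_(j < n.+1) F j)%N.
  (* The convolution has n + 1 terms and the Eulerian sum k; both are padded to n + 1 + k by zeros,
     from the binomial past n and from [eulerian2] past k. *)
  rewrite -(sum_ord_vanish F n.+1 (n.+1 + k)) ?leq_addr // => [|j lt_nj].
    rewrite (sum_ord_vanish F k) ?leq_addl // => j le_kj.
    by rewrite /F eulerian2_large.
  by rewrite /F bin_small ?muln0 //; lia.
rewrite natr_sum; apply: eq_bigr => j _.
rewrite addn1 fps_inv_one_subX_exp natrM -addnBAC; last by rewrite -ltnS.
congr (_ * _); rewrite /fps_of_poly big_add1 big_mkord /=.
rewrite -(poly_def k (fun i => (eulerian2 k i.+1)%:R)) coef_poly.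
by case: ltnP => // le_kj; rewrite eulerian2_large.
Qed.

Theorem theorem6p2 (R : realType) (k : nat) (hk : (1 <= k)%N) :
  Ehr (@order_polytope R _ (barP k)) =
  fps_div
    (fps_of_poly
       (\sum_(1 <= i < k.+1) ((eulerian2 k i)%:R : int) *: 'X^(i.-1)))
    (fps_of_poly ((1 - 'X) ^+ (2 * k + 1))).
Proof.
apply/funext => n; rewrite eulerian2_gfE // -size_chainsE //.
(* The constant term 1, set by convention in [Ehr], matches the single all-zero chain. *)
case: n => [|n]; first by rewrite size_chains0.
by rewrite /Ehr ehr_barP // natz.
Qed.
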